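(* Let $G$ be an affine algebraic group over $\Bbbk$ acting regularly on an affine variety $X$, and assume that the action is linearly reductive. Consider the affine variety $Y$ having ${}^G\Bbbk[X]$ as algebra of polynomial functions and let $\pi: X\to Y$ be the associated morphism (corresponding to the inclusion ${}^G\Bbbk[X]\subseteq\Bbbk[X]$). Then the pair $(Y,\pi)$ is a semi-geometric quotient of $X$ by $G$.
   Context: $\Bbbk$ is an algebraically closed field; all algebras are commutative. Geometric actions are on the right, and for a regular right action of $G$ on an affine variety $X$, $\Bbbk[X]$ is a rational $G$-module algebra via $(g\cdot f)(x)=f(x\cdot g)$. For a rational $G$-module algebra $R$ (commutative $\Bbbk$-algebra and rational $G$-module with $G$ acting by algebra automorphisms), a $(G,R)$-module is a rational $G$-module $M$ that is also an $R$-module with $x\cdot(rm) = (x\cdot r)(x\cdot m)$; morphisms are $G$-equivariant $R$-linear maps; ${}^G M$ is the set of $G$-fixed elements. The action of $G$ on $R$ is linearly reductive if for every $(G,R)$-module $M$, every $G$-stable ideal $J\subseteq R$ and every surjective morphism of $(G,R)$-modules $\lambda: M\to R/J$, there exists $m\in {}^G M$ with $\lambda(m)=1+J$. The action of $G$ on $X$ is linearly reductive if the action of $G$ on $\Bbbk[X]$ is; in that case ${}^G\Bbbk[X]$ is a finitely generated $\Bbbk$-algebra. A semi-geometric quotient of $X$ by $G$ is a pair $(Y,\pi)$ where $Y$ is a variety and $\pi:X\to Y$ is a morphism such that: (i) $\pi$ is surjective and constant on $G$-orbits; (ii) for every open subset $V\subseteq Y$, the pullback $\pi^{\#}:\mathcal{O}_Y(V)\to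 {}^G\mathcal{O}_X(\pi^{-1}(V))$ is an isomorphism; (iii) if $W\subseteq X$ is closed and $G$-stable then $\pi(W)$ is closed in $Y$, and if $W_1,W_2\subseteq X$ are disjoint closed $G$-stable subsets then $\pi(W_1)\cap\pi(W_2)=\emptyset$. *)

(* Defs.v *)
From HB Require Import structures.
From mathcomp Require Import all_boot all_order all_algebra.
From mathcomp Require Import all_classical.
From mathcomp Require Import topology.

Set Implicit Arguments.
Unset Strict Implicit.
Unset Printing Implicit Defensive.

Import GRing.Theory.

Local Open Scope classical_set_scope.
Local Open Scope ring_scope.

(* Commutative k-algebras.  The library's comAlgType requires 1 != 0, which
   would exclude the coordinate algebra of the empty variety. *)
Record algebra (k : fieldType) := Algebra {
  alg_ring :> comPzRingType;
  alg_const : {rmorphism k -> alg_ring}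
}.

Definition subalgebra (k : fieldType) (A : algebra k) (S : set A) : Prop :=
  [/\ forall c, S (alg_const A c),
      forall x y, S x -> S y -> S (x + y) &
      forall x y, S x -> S y -> S (x * y)].

Definition finitely_generated (k : fieldType) (A : algebra k) : Prop :=
  exists s : seq A, forall S : set A,
    subalgebra S -> (forall x, x \in s -> S x) -> S = setT.

Definition restrict_scalars (k : fieldType) (A : algebra k) (M : lmodType A)
  : Type := M.

Section RestrictScalars.
Variables (k : fieldType) (A : algebra k) (M : lmodType A).
Local Notation V := (restrict_scalars M).

HB.instance Definition _ := GRing.Zmodule.on V.

Let scale (c : k) (v : V) : V := alg_const A c *: (v : M).

Let scaleA c d v : scale c (scale d v) = scale (c * d) v.
Proof. by rewrite /scale scalerA rmorphM. Qed.

Let scale1 : left_id 1 scale.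
Proof. by move=> v; rewrite /scale rmorph1 scale1r. Qed.

Let scaleDr : right_distributive scale +%R.
Proof. by move=> c u v; rewrite /scale scalerDr. Qed.

Let scaleDl v : {morph scale^~ v : c d / c + d}.
Proof. by move=> c d; rewrite /scale rmorphD scalerDl. Qed.

HB.instance Definition _ :=
  GRing.Zmodule_isLmodule.Build k V scaleA scale1 scaleDr scaleDl.

Lemma restrict_scaleE c (v : V) : c *: v = alg_const A c *: (v : M).
Proof. by []. Qed.

End RestrictScalars.

Lemma cst_is_monoid_morphism (T : Type) (k : fieldType) :
  monoid_morphism (cst : k -> (T -> k)).
Proof. by []. Qed.

Lemma cst_is_zmod_morphism (T : Type) (k : fieldType) :
  zmod_morphism (cst : k -> (T -> k)).
Proof. by []. Qed.

HB.instance Definition _ (T : Type) (k : fieldType) :=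
  GRing.isZmodMorphism.Build k (T -> k) cst (@cst_is_zmod_morphism T k).
HB.instance Definition _ (T : Type) (k : fieldType) :=
  GRing.isMonoidMorphism.Build k (T -> k) cst (@cst_is_monoid_morphism T k).

Definition fun_algebra (T : Type) (k : fieldType) : algebra k :=
  @Algebra k (T -> k) cst.

(* Spaces with functions (Kempf): a topological space with a sheaf of algebras
   of k-valued functions.  A section over U is represented by any function on
   the whole space that extends it: [regular U f] only depends on the values of
   f on U, and two sections over U are equal when they agree on U. *)
HB.mixin Record hasRegularFunctions (k : closedFieldType) X of Topological X := {
  regular : set X -> set (X -> k);
  regular_ext : forall (U : set X) (f g : X -> k),
    (forall x, U x -> f x = g x) -> regular U f -> regular U g;
  regular_subalgebra : forall U : set X, open U ->
    @subalgebra k (fun_algebra X k) (regular U);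
  regular_sheaf : forall (I : Type) (U : I -> set X) (f : X -> k),
    (forall i, open (U i)) ->
    regular (\bigcup_i U i) f <-> (forall i, regular (U i) f);
  regular_inv : forall (U : set X) (f : X -> k), open U -> regular U f ->
    open (U `&` [set x | f x != 0]) /\
    regular (U `&` [set x | f x != 0]) (fun x => (f x)^-1)
}.

#[short(type="spaceWithFunctions")]
HB.structure Definition SpaceWithFunctions (k : closedFieldType) :=
  { X of Topological X & hasRegularFunctions k X }.

Definition is_morphism (k : closedFieldType) (X Y : spaceWithFunctions k)
    (p : X -> Y) : Prop :=
  continuous p /\
  forall (V : set Y) (s : Y -> k), open V ->
    regular V s -> regular (p @^-1` V) (s \o p).

Definition global_functions (k : closedFieldType) (X : spaceWithFunctions k) :
  set (X -> k) := @regular k X [set: X].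

Definition coord_ring (k : closedFieldType) (X : spaceWithFunctions k) :=
  {f : X -> k | f \in @global_functions k X}.

Section CoordRing.
Variables (k : closedFieldType) (X : spaceWithFunctions k).

Lemma global_functions_subalgebra :
  @subalgebra k (fun_algebra X k) (@global_functions k X).
Proof. exact/regular_subalgebra/openT. Qed.

Lemma global_functions_subring :
  subring_closed [pred f | f \in @global_functions k X].
Proof.
have [gC gD gM] := global_functions_subalgebra.
split=> [|f g|f g]; rewrite !inE => //.
- exact: (gC 1).
- move=> gf gg; apply: gD => //.
  have -> : - g = cst (- 1) * g by apply/funext => x; rewrite !fctE mulN1r.
  by apply: gM => //; exact: gC.
- exact: gM.
Qed.

HB.instance Definition _ := [isSub of coord_ring X for sval].
HB.instance Definition _ := [Choice of coord_ring X by <:].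
HB.instance Definition _ := GRing.SubChoice_isSubComPzRing.Build (X -> k) _
  (coord_ring X) global_functions_subring.

Lemma cst_global (c : k) : cst c \in @global_functions k X.
Proof. by rewrite inE; have [gC _ _] := global_functions_subalgebra; exact: gC. Qed.

Definition coord_const (c : k) : coord_ring X := exist _ (cst c) (cst_global c).

Lemma coord_const_is_monoid_morphism : monoid_morphism coord_const.
Proof. by split=> [|c d]; apply/val_inj. Qed.

Lemma coord_const_is_zmod_morphism : zmod_morphism coord_const.
Proof. by move=> c d; apply/val_inj. Qed.

HB.instance Definition _ := GRing.isZmodMorphism.Build k (coord_ring X)
  coord_const coord_const_is_zmod_morphism.
HB.instance Definition _ := GRing.isMonoidMorphism.Build k (coord_ring X)
  coord_const coord_const_is_monoid_morphism.

(* k[X] *)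
Definition coord_algebra : algebra k := @Algebra k (coord_ring X) coord_const.

End CoordRing.

(* X is the maximal spectrum of k[X] with its Zariski topology, and its regular
   functions are locally fractions of elements of k[X] *)
Record is_affine (k : closedFieldType) (X : spaceWithFunctions k) : Prop := {
  affine_fg : finitely_generated (coord_algebra X);
  affine_points : forall phi : {rmorphism coord_algebra X -> k},
    (forall c : k, phi (alg_const (coord_algebra X) c) = c) ->
    exists! x : X, forall f : coord_ring X, phi f = val f x;
  affine_closed : forall C : set X, closed C <->
    exists2 S : set (X -> k), S `<=` @global_functions k X &
      C = [set x | forall f, S f -> f x = 0];
  affine_regular : forall (U : set X) (f : X -> k), open U ->
    regular U f <->
    forall x, U x -> exists V p q,
      [/\ open V, V x, V `<=` U,
          @global_functions k X p /\ @global_functions k X q &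
          forall y, V y -> q y != 0 /\ f y = p y / q y]
}.

Definition is_open_immersion (k : closedFieldType) (A X : spaceWithFunctions k)
    (phi : A -> X) : Prop :=
  [/\ injective phi,
      forall W : set A, open W <-> open (phi @` W) &
      forall (W : set A) (f : X -> k), open W ->
        regular W (f \o phi) <-> regular (phi @` W) f].

Definition is_prevariety (k : closedFieldType) (X : spaceWithFunctions k) :=
  exists (n : nat) (A : 'I_n -> spaceWithFunctions k)
         (phi : forall i, A i -> X),
    (forall i, is_affine (A i) /\ is_open_immersion (phi i)) /\
    \bigcup_i range (phi i) = [set: X].

(* Separatedness in the form of Mumford's definition: the locus where two
   morphisms to X agree is closed. *)
Definition is_variety (k : closedFieldType) (X : spaceWithFunctions k) :=
  is_prevariety X /\
  forall (Z : spaceWithFunctions k) (p q : Z -> X), is_prevariety Z ->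
    is_morphism p -> is_morphism q -> closed [set z | p z = q z].

(* The coordinate algebra of the product of two affine varieties, that is
   k[X] (x) k[Y] as an algebra of functions on X * Y *)
Definition prod_functions (k : closedFieldType) (X Y : spaceWithFunctions k)
    : set (X * Y -> k) :=
  [set F | exists (n : nat) (a : 'I_n -> X -> k) (b : 'I_n -> Y -> k),
    [/\ forall i, global_functions (a i), forall i, global_functions (b i) &
        forall x y, F (x, y) = \sum_i a i x * b i y]].

(* Morphisms X * Y -> Z for X, Y and Z affine *)
Definition is_prod_morphism (k : closedFieldType) (X Y Z : spaceWithFunctions k)
    (m : X * Y -> Z) : Prop :=
  forall f : Z -> k, global_functions f -> prod_functions (f \o m).

HB.mixin Record isAffineAlgebraicGroup (k : closedFieldType) G
    of Group G & SpaceWithFunctions k G := {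
  group_affine : is_affine G;
  mulg_morphism : is_prod_morphism (fun gh : G * G => (gh.1 * gh.2)%g);
  invg_morphism : is_morphism (fun g : G => (g^-1)%g)
}.

#[short(type="affineAlgebraicGroup")]
HB.structure Definition AffineAlgebraicGroup (k : closedFieldType) :=
  { G of Group G & SpaceWithFunctions k G & isAffineAlgebraicGroup k G }.

Record regular_action (k : closedFieldType) (G : affineAlgebraicGroup k)
    (X : spaceWithFunctions k) := RegularAction {
  act :> X -> G -> X;
  act1 : forall x, act x 1%g = x;
  actM : forall x g h, act x (g * h)%g = act (act x g) h;
  act_morphism : is_prod_morphism (fun xg : X * G => act xg.1 xg.2)
}.

Record is_rational (k : closedFieldType) (G : affineAlgebraicGroup k)
    (V : lmodType k) (rho : G -> V -> V) : Prop := {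
  rational_linear : forall g (c : k) u v,
    rho g (c *: u + v) = c *: rho g u + rho g v;
  rational1 : forall v, rho 1%g v = v;
  rationalM : forall g h v, rho (g * h)%g v = rho g (rho h v);
  (* v lies in a finite-dimensional G-stable subspace, with basis e, on which
     the matrix coefficients of G are regular functions *)
  rational_finite : forall v, exists (n : nat) (e : 'I_n -> V)
      (c : 'I_n -> 'I_n -> G -> k),
    [/\ forall a : 'I_n -> k, \sum_i a i *: e i = 0 -> forall i, a i = 0,
        exists a : 'I_n -> k, v = \sum_i a i *: e i,
        forall i j, global_functions (c i j) &
        forall g j, rho g (e j) = \sum_i c i j g *: e i]
}.

Definition fixed_points (G : Type) (M : Type) (rho : G -> M -> M) : set M :=
  [set m | forall g, rho g m = m].

Record rational_algebra (k : closedFieldType) (G : affineAlgebraicGroup k) :=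
    RationalAlgebra {
  ra_alg :> algebra k;
  ra_act : G -> ra_alg -> ra_alg;
  ra_rational :
    @is_rational k G (restrict_scalars (ra_alg^o : lmodType ra_alg)) ra_act;
  ra_act1 : forall g, ra_act g 1 = 1;
  ra_actM : forall g r s, ra_act g (r * s) = ra_act g r * ra_act g s
}.

(* The k-vector space structure of a (G, R)-module is the one induced from R. *)
Record GR_module (k : closedFieldType) (G : affineAlgebraicGroup k)
    (R : rational_algebra G) := GRModule {
  gr_mod :> lmodType R;
  gr_act : G -> gr_mod -> gr_mod;
  gr_rational : @is_rational k G (restrict_scalars gr_mod) gr_act;
  gr_actZ : forall g (r : R) m, gr_act g (r *: m) = ra_act g r *: gr_act g m
}.

Section LinearlyReductive.
Variables (k : closedFieldType) (G : affineAlgebraicGroup k).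
Variable R : rational_algebra G.

Definition is_stable_ideal (J : zmodClosed R) : Prop :=
  (forall r x, x \in J -> r * x \in J) /\
  (forall g x, x \in J -> ra_act g x \in J).

(* The actions of R and G on R / J; [repr] picks a representative, whose choice
   is irrelevant when J is a G-stable ideal. *)
Definition quot_scale (J : zmodClosed R) (r : R) (x : Quotient.quot J) :=
  (\pi_(Quotient.quot J) (r * repr x))%qT.
Definition quot_act (J : zmodClosed R) (g : G) (x : Quotient.quot J) :=
  (\pi_(Quotient.quot J) (ra_act g (repr x)))%qT.

Definition is_GR_morphism_to_quot (J : zmodClosed R) (M : GR_module R)
    (lambda : M -> Quotient.quot J) : Prop :=
  [/\ forall m n, lambda (m + n) = lambda m + lambda n,
      forall r m, lambda (r *: m) = quot_scale r (lambda m) &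
      forall g m, lambda (gr_act g m) = quot_act g (lambda m)].

Definition linearly_reductive : Prop :=
  forall (M : GR_module R) (J : zmodClosed R) (lambda : M -> Quotient.quot J),
    is_stable_ideal J -> is_GR_morphism_to_quot lambda ->
    range lambda = [set: Quotient.quot J] ->
    exists2 m, fixed_points (@gr_act _ _ _ M) m &
      lambda m = (\pi_(Quotient.quot J) 1)%qT.

End LinearlyReductive.

(* A vector whose orbit map g |-> g v is a combination of finitely many vectors
   with regular coefficients generates a finite-dimensional rational module. *)
Section RationalCriterion.
Variables (k : closedFieldType) (G : affineAlgebraicGroup k).

Lemma global_sum (X : spaceWithFunctions k) (n : nat) (a : 'I_n -> k)
    (f : 'I_n -> X -> k) :
  (forall i, global_functions (f i)) ->
  global_functions (fun x => \sum_i a i * f i x).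
Proof.
move=> gf; have [gC gD gM] := @global_functions_subalgebra k X.
have -> : (fun x => \sum_i a i * f i x) = \sum_i (cst (a i) * f i).
  by apply/funext => x; rewrite fct_sumE.
apply: big_ind => [|? ?|i _]; [exact: (gC 0)|exact: gD|].
by apply: gM => //; exact: gC.
Qed.

Lemma global_translate (f : G -> k) (h : G) : global_functions f ->
  global_functions (fun g : G => f (g * h)%g).
Proof.
move=> /(@mulg_morphism k G) [n [a [b [ga gb E]]]].
have -> : (fun g : G => f (g * h)%g) = (fun g => \sum_i b i h * a i g).
  apply/funext => g; have /= -> := E g h.
  by apply: eq_bigr => i _; rewrite mulrC.
exact: global_sum.
Qed.

Lemma independent_evaluations (T : Type) (n : nat) (f : 'I_n -> T -> k) :
  (exists a : 'I_n -> k, (exists i, a i != 0) /\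
     forall t, \sum_i a i * f i t = 0) \/
  exists t : 'I_n -> T, (\matrix_(i, j) f j (t i)) \in unitmx.
Proof.
pose P r := `[< exists t : 'I_r -> T, \rank (\matrix_(i, j) f j (t i)) = r >].
have P0 : exists r, P r.
  have t : 'I_0 -> T by case.
  exists 0%N; apply/asboolP; exists t.
  by apply/eqP; rewrite -leqn0 rank_leq_row.
have Pn r : P r -> (r <= n)%N by move=> /asboolP [t <-]; exact: rank_leq_col.
case: (ex_maxnP P0 Pn) => r /asboolP[t rt] rmax.
have [rn|nr] := eqVneq r n.
  by subst r; right; exists t; rewrite -row_full_unit /row_full rt.
left; set B := \matrix_(i, j) _ in rt.
have ltrn : (r < n)%N by rewrite ltn_neqAle nr Pn //; apply/asboolP; exists t.
have : kermx B^T != 0.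
  by rewrite -mxrank_eq0 mxrank_ker mxrank_tr rt subn_eq0 -ltnNge.
move=> /rowV0Pn[u /sub_kermxP uB u0].
exists (fun i => u 0 i); split.
  apply: contra_neqP u0 => nu; apply/rowP => i; rewrite mxE.
  by apply: contra_notP nu => /eqP ui; exists i.
move=> s; set v : 'rV_n := \row_j f j s.
have [/submxP[w vB]|vB] := boolP (v <= B)%MS.
  have : (u *m v^T) 0 0 = 0 by rewrite vB trmx_mul mulmxA uB mul0mx mxE.
  by rewrite mxE; apply: etrans; apply: eq_bigr => i _; rewrite !mxE.
have : P (r + 1)%N.
  apply/asboolP.
  exists (fun j => match fintype.split j with inl i => t i | inr _ => s end).
  set C := \matrix_(i, j) _.
  have -> : C = col_mx B v.
    by apply/matrixP => i j; rewrite !mxE; case: splitP => l _; rewrite mxE.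
  apply/eqP; rewrite eqn_leq rank_leq_row /= -addsmxE addn1 -[X in (X < _)%N]rt.
  apply: rank_ltmx; rewrite ltmxE addsmxSl /=.
  by apply: contra vB; apply: submx_trans; rewrite addsmxSr.
by move=> /rmax; rewrite addn1 ltnn.
Qed.

Variables (V : lmodType k) (rho : G -> V -> V).
Hypothesis rho_linear : forall g (c : k) u v,
  rho g (c *: u + v) = c *: rho g u + rho g v.
Hypothesis rho1 : forall v, rho 1%g v = v.
Hypothesis rhoM : forall g h v, rho (g * h)%g v = rho g (rho h v).

Lemma rho_sum g (n : nat) (a : 'I_n -> k) (e : 'I_n -> V) :
  rho g (\sum_i a i *: e i) = \sum_i a i *: rho g (e i).
Proof.
have r0 : rho g 0 = 0.
  by have := rho_linear g (-1) 0 0; rewrite scaler0 addr0 scaleN1r addNr.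
elim/big_rec2: _ => [//|i u v _ <-]; exact: rho_linear.
Qed.

Lemma drop_term (n : nat) (a : 'I_n.+1 -> k) (i : 'I_n.+1) :
  a i != 0 -> forall (W : lmodType k) (x : 'I_n.+1 -> W),
  \sum_l a l *: x l = 0 ->
  x i = \sum_l (- (a (lift i l) / a i)) *: x (lift i l).
Proof.
move=> ai W x; rewrite (bigD1_ord i) //= => /eqP; rewrite addr_eq0 => /eqP E.
rewrite -[LHS](scalerK ai) E scalerN scaler_sumr -sumrN.
by apply: eq_bigr => l _; rewrite scalerA scaleNr mulrC.
Qed.

Lemma rational_finiteI (v : V) (n : nat) (e : 'I_n -> V) (f : 'I_n -> G -> k) :
  (forall i, global_functions (f i)) ->
  (forall g, rho g v = \sum_i f i g *: e i) ->
  exists (n : nat) (e : 'I_n -> V) (c : 'I_n -> 'I_n -> G -> k),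
    [/\ forall a : 'I_n -> k, \sum_i a i *: e i = 0 -> forall i, a i = 0,
        exists a : 'I_n -> k, v = \sum_i a i *: e i,
        forall i j, global_functions (c i j) &
        forall g j, rho g (e j) = \sum_i c i j g *: e i].
Proof.
have [gC gD gM] := @global_functions_subalgebra k G.
elim: n e f => [|n IHn] e f gf E.
  exists 0%N, e, (fun i _ => f i); split=> // [a _ []//||g []//].
  by exists (fun=> 0); rewrite -{1}(rho1 v) E !big_ord0.
have [[a [[i ai] a0]]|[t tU]] := independent_evaluations f.
  have fE g : f i g = \sum_l (- (a (lift i l) / a i)) * f (lift i l) g.
    exact: (@drop_term _ _ _ ai k^o (fun l => f l g) (a0 g)).
  apply: (IHn (fun l => e (lift i l) - (a (lift i l) / a i) *: e i)
              (fun l => f (lift i l))) => // g.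
  rewrite E (bigD1_ord i) //= fE scaler_suml -big_split /=.
  apply: eq_bigr => l _; rewrite scalerBr addrC scalerA mulNr scaleNr.
  by rewrite [_ * f _ g]mulrC.
have [[a [a0 [i ai]]]|free] := pselect (exists a : 'I_n.+1 -> k,
    \sum_i a i *: e i = 0 /\ exists i, a i != 0).
  apply: (IHn (fun l => e (lift i l))
    (fun l g => f (lift i l) g + (- (a (lift i l) / a i)) * f i g)) => [l|g].
    by apply: gD => //; apply: (gM (cst _)) => //; exact: gC.
  rewrite E (bigD1_ord i) //= (drop_term ai a0) scaler_sumr -big_split /=.
  by apply: eq_bigr => l _; rewrite scalerDl scalerA addrC [f i g * _]mulrC.
set B := \matrix_(i, j) f j (t i) in tU.
pose D := invmx B.
have eE j : e j = \sum_i D j i *: rho (t i) v.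
  transitivity (\sum_l (D *m B) j l *: e l).
    rewrite mulVmx // (bigD1 j) //= mxE eqxx scale1r big1 ?addr0 // => l lj.
    by rewrite mxE eq_sym (negbTE lj) scale0r.
  under [RHS]eq_bigr do rewrite E scaler_sumr.
  rewrite exchange_big /=; apply: eq_bigr => l _.
  rewrite mxE scaler_suml; apply: eq_bigr => i _.
  by rewrite scalerA mxE.
exists n.+1, e, (fun i j g => \sum_l D j l * f i (g * t l)%g); split.
- move=> a a0 i; apply: contra_notP free => /eqP ai; exists a; split=> //.
  by exists i.
- by exists (fun i => f i 1%g); rewrite -E rho1.
- by move=> i j; apply: global_sum => l; exact: global_translate.
- move=> g j; rewrite {1}eE rho_sum.
  under eq_bigr do rewrite -rhoM E scaler_sumr.
  rewrite exchange_big /=; apply: eq_bigr => i _.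
  by rewrite scaler_suml; apply: eq_bigr => l _; rewrite scalerA.
Qed.

End RationalCriterion.

Section CoordinateAction.
Variables (k : closedFieldType) (G : affineAlgebraicGroup k).
Variables (X : spaceWithFunctions k) (a : regular_action G X).

Lemma coord_act_global (g : G) (f : coord_ring X) :
  (fun x => val f (a x g)) \in @global_functions k X.
Proof.
have /= := valP f; rewrite !inE => /(act_morphism a)[n [b [c [gb gc E]]]].
have -> : (fun x => val f (a x g)) = (fun x => \sum_i c i g * b i x).
  apply/funext => x; have /= -> := E x g.
  by apply: eq_bigr => i _; rewrite mulrC.
exact: global_sum.
Qed.

Definition coord_act (g : G) (f : coord_algebra X) : coord_algebra X :=
  exist _ (fun x => val (f : coord_ring X) (a x g)) (coord_act_global g f).

Lemma coord_act_rational : @is_rational k G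
  (restrict_scalars ((coord_algebra X)^o : lmodType (coord_algebra X)))
  coord_act.
Proof.
have lin : forall g (c : k) (u v : restrict_scalars
    ((coord_algebra X)^o : lmodType (coord_algebra X))),
  coord_act g (c *: u + v) = c *: (coord_act g u : restrict_scalars
    ((coord_algebra X)^o : lmodType (coord_algebra X))) + coord_act g v.
  by move=> g c u v; apply/val_inj.
have one : forall v, coord_act 1%g v = v.
  by move=> v; apply/val_inj/funext => x /=; rewrite act1.
have mul : forall g h v, coord_act (g * h)%g v = coord_act g (coord_act h v).
  by move=> g h v; apply/val_inj/funext => x /=; rewrite actM.
split=> // v.
have /= := valP (v : coord_ring X).
rewrite !inE => /(act_morphism a)[n [b [c [gb gc E]]]].
have gb' i : b i \in @global_functions k X by rewrite inE.
pose e i : restrict_scalars ((coord_algebra X)^o : lmodType (coord_algebra X)) :=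
  (exist _ (b i) (gb' i) : coord_ring X).
apply: (rational_finiteI lin one mul (e := e) gc) => g.
apply/val_inj/funext => x /=; have /= -> := E x g.
set s := (\sum_i _ in RHS).
have -> : val (s : coord_ring X) = \sum_i cst (c i g) * b i.
  by rewrite /s (raddf_sum (val : coord_ring X -> X -> k)).
by rewrite fct_sumE; apply: eq_bigr => i _; rewrite mulrC.
Qed.

Lemma coord_act1 g : coord_act g 1 = 1.
Proof. exact/val_inj. Qed.

Lemma coord_actM g (r s : coord_algebra X) :
  coord_act g (r * s) = coord_act g r * coord_act g s.
Proof. exact/val_inj. Qed.

Definition coord_rational_algebra : rational_algebra G :=
  RationalAlgebra coord_act_rational coord_act1 coord_actM.

Definition linearly_reductive_action : Prop :=
  linearly_reductive coord_rational_algebra.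

End CoordinateAction.

(* phi identifies k[Y] with the subalgebra of G-invariants of k[X] *)
Definition is_iso_onto_invariants (k : closedFieldType)
    (G : affineAlgebraicGroup k) (X Y : spaceWithFunctions k)
    (a : regular_action G X)
    (phi : {rmorphism coord_algebra Y -> coord_algebra X}) : Prop :=
  (forall c : k, phi (alg_const (coord_algebra Y) c) =
                 alg_const (coord_algebra X) c) /\
  set_bij [set: coord_algebra Y] (fixed_points (coord_act a)) phi.

(* p is the map X -> Y whose comorphism is phi *)
Definition has_comorphism (k : closedFieldType) (X Y : spaceWithFunctions k)
    (phi : coord_algebra Y -> coord_algebra X) (p : X -> Y) : Prop :=
  forall (h : coord_ring Y) (x : X),
    val h (p x) = val (phi h : coord_ring X) x.

Section SemiGeometricQuotient.
Variables (k : closedFieldType) (G : affineAlgebraicGroup k).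
Variables (X : spaceWithFunctions k) (a : regular_action G X).

Definition stable (W : set X) : Prop := forall x g, W x -> W (a x g).

(* The sections over a G-stable open set U fixed by (g . f)(x) = f (x . g) *)
Definition invariant_functions (U : set X) : set (X -> k) :=
  [set f | regular U f /\ forall x g, U x -> f (a x g) = f x].

(* The pullback is an algebra homomorphism for the pointwise operations, so it
   is an isomorphism when it is well defined and bijective.  Sections over an
   open set are compared on that set only. *)
Definition pullback_iso (Y : spaceWithFunctions k) (p : X -> Y) (V : set Y) :=
  [/\ forall s, regular V s -> invariant_functions (p @^-1` V) (s \o p),
      forall s t, regular V s -> regular V t ->
        (forall x, (p @^-1` V) x -> s (p x) = t (p x)) ->
        forall y, V y -> s y = t y &
      forall f, invariant_functions (p @^-1` V) f ->
        exists2 s, regular V s & forall x, (p @^-1` V) x -> s (p x) = f x].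

Record is_semi_geometric_quotient (Y : spaceWithFunctions k) (p : X -> Y)
    : Prop := {
  sgq_variety : is_variety Y;
  sgq_morphism : is_morphism p;
  sgq_surjective : range p = [set: Y];
  sgq_orbits : forall x g, p (a x g) = p x;
  sgq_pullback : forall V : set Y, open V -> pullback_iso p V;
  sgq_closed : forall W : set X, closed W -> stable W -> closed (p @` W);
  sgq_disjoint : forall W1 W2 : set X,
    closed W1 -> stable W1 -> closed W2 -> stable W2 ->
    W1 `&` W2 = set0 -> p @` W1 `&` p @` W2 = set0
}.

End SemiGeometricQuotient.

(* Main.v *)
(* Apply linear reductivity to the free module M = k[X]^n, mapped to k[X] / I(W)
   for a stable closed W by a row (u_1, ..., u_n) whose entries are invariant on
   W: if the u_i generate the unit ideal modulo I(W), then 1 is a combination of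
   the u_i modulo I(W) with invariant coefficients.
   - If y is in the closure of p(W) but not in p(W), the Nullstellensatz gives
     1 in I(W) + m_y k[X]; making the coefficients invariant yields an element
     of 1 + m_y that vanishes on p(W), a contradiction.  So p(W) is closed, and
     W = X gives surjectivity.
   - For disjoint W1 and W2, apply it with n = 1 to W = W1 U W2 and a function u
     equal to 1 on W1 and to a constant c != 0, 1 on W2.
   - An invariant section over p^-1(V) is, by the Nullstellensatz, g / u^n on a
     basic open set X_u with u invariant, and then u g is a global invariant.
   The Nullstellensatz itself is proved for primes of iterated polynomial rings,
   adjoining one variable at a time. *)
Require Import Defs.
From HB Require Import structures.
From mathcomp Require Import all_boot all_order all_algebra.
From mathcomp Require Import all_classical.
From mathcomp Require Import topology.

Set Implicit Arguments.
Unset Strict Implicit.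
Unset Printing Implicit Defensive.

Import GRing.Theory.
Import Pdiv.Idomain.

Local Open Scope classical_set_scope.
Local Open Scope ring_scope.

(** * Ideals and primes of commutative rings *)

Definition is_ideal (A : comPzRingType) (I : set A) : Prop :=
  [/\ I 0, forall x y, I x -> I y -> I (x + y) & forall a x, I x -> I (a * x)].

Definition is_prime (A : comPzRingType) (P : set A) : Prop :=
  forall x y, P (x * y) -> P x \/ P y.

Section Ideals.
Variable A : comPzRingType.
Implicit Type I P : set A.

Lemma idealN I x : is_ideal I -> I x -> I (- x).
Proof. by move=> [_ _ IM] Ix; rewrite -mulN1r; exact: IM. Qed.

Lemma idealB I x y : is_ideal I -> I x -> I y -> I (x - y).
Proof.
by move=> II Ix Iy; case: (II) => _ ID _; apply: ID => //; exact: idealN.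
Qed.

Lemma ideal_sum I (T : Type) (s : seq T) (Q : pred T) (f : T -> A) :
  is_ideal I -> (forall i, Q i -> I (f i)) -> I (\sum_(i <- s | Q i) f i).
Proof. by move=> [I0 ID _] If; elim/big_ind: _. Qed.

Lemma ideal_adjoin I b : is_ideal I ->
  is_ideal [set x | exists2 y, I y & exists c, x = y + c * b].
Proof.
move=> [I0 ID IM]; split.
- by exists 0 => //; exists 0; rewrite mul0r addr0.
- move=> _ _ [y Iy [c ->]] [z Iz [d ->]]; exists (y + z); first exact: ID.
  by exists (c + d); rewrite mulrDl addrACA.
- move=> a _ [y Iy [c ->]]; exists (a * y); first exact: IM.
  by exists (a * c); rewrite mulrDr mulrA.
Qed.

Lemma primeX P x n : is_prime P -> ~ P 1 -> P (x ^+ n) -> P x.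
Proof. by move=> Pp P1; elim: n => // n IHn; rewrite exprS => /Pp[]. Qed.

(* Krull: an ideal maximal among those avoiding the powers of [u] is prime. *)
Lemma prime_avoiding_powers I u : is_ideal I -> (forall n, ~ I (u ^+ n)) ->
  exists P, [/\ is_ideal P, is_prime P, I `<=` P & ~ P u].
Proof.
move=> II uI.
have [F FP Ftot|P [[P0|[idP IP uP]] Pmax]] := @Zorn_bigcup A
  [set J | J = set0 \/ [/\ is_ideal J, I `<=` J & forall n, ~ J (u ^+ n)]].
- have FPi K x : F K -> K x ->
      [/\ is_ideal K, I `<=` K & forall n, ~ K (u ^+ n)].
    by move=> FK Kx; have [K0|//] := FP _ FK; rewrite K0 in Kx.
  have [[J FJ J0]|F0] := pselect (exists2 J, F J & J <> set0); last first.
    left; apply/seteqP; split=> // x [J FJ Jx]; apply: F0; exists J => //.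
    by move=> J0; rewrite J0 in Jx.
  have [//|[[? ? ?] IJ _]] := FP _ FJ.
  right; split; [split|by move=> x /IJ; exists J|].
  + by exists J.
  + move=> x y [K FK Kx] [L FL Ly]; have [KL|LK] := Ftot _ _ FK FL.
      exists L => //; have [[_ LD _] _ _] := FPi _ _ FL Ly.
      by apply: LD => //; exact: KL.
    exists K => //; have [[_ KD _] _ _] := FPi _ _ FK Kx.
    by apply: KD => //; exact: LK.
  + move=> b x [K FK Kx]; exists K => //.
    by have [[_ _ KM] _ _] := FPi _ _ FK Kx; exact: KM.
  + by move=> n [K FK Ku]; have [_ _] := FPi _ _ FK Ku; apply; exact: Ku.
- exfalso; apply: (Pmax I); last by right; split.
  rewrite P0; split=> // sub; case: II => /sub //.
(* By maximality, adjoining any [x] outside [P] brings in a power of [u]; multiplying two such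
   powers gives primality. *)
- have adjoinP x : ~ P x -> exists n y c, P y /\ u ^+ n = y + c * x.
    move=> nPx; pose J := [set z | exists2 y, P y & exists c, z = y + c * x].
    have PJ : P `<=` J.
      by move=> z Pz; exists z => //; exists 0; rewrite mul0r addr0.
    apply: contrapT => nE; apply: (Pmax J).
      split=> // JP; apply: nPx; apply: JP; exists 0; first by case: idP.
      by exists 1; rewrite mul1r add0r.
    right; split; [exact: ideal_adjoin|exact: subset_trans PJ|].
    by move=> n [y Py [c E]]; apply: nE; exists n, y, c.
  exists P; split=> //; last exact: (uP 1%N).
  move=> x y Pxy; apply: contrapT => /not_orP[/adjoinP[n [v [c [Pv Ev]]]]].
  move=> /adjoinP[m [w [d [Pw Ew]]]]; apply: (uP (n + m)%N).
  have [_ PD PM] := idP.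
  rewrite exprD Ev Ew mulrDl [c * x * _]mulrDr mulrACA; apply: (PD).
    by rewrite mulrC; exact: PM.
  by apply: PD; exact: PM.
Qed.

End Ideals.

(** * Prime ideals of a polynomial ring in one variable *)

Section PolynomialStep.
Variables (D : idomainType) (P : set {poly D}).
Hypotheses (idP : is_ideal P) (primeP : is_prime P).

Definition const_part : set D := [set a | P a%:P].
(** The ideal generated by the contraction of [P] to [D], tested on coefficients. *)
Definition in_const_part (p : {poly D}) : Prop := forall j, const_part p`_j.
Local Notation Q := const_part.
Local Notation QX := in_const_part.

Lemma const_part_ideal : is_ideal Q.
Proof.
have [P0 PD PM] := idP; split; rewrite /Q /= ?polyC0 //.
- by move=> x y; rewrite polyCD; exact: PD.
- by move=> a x; rewrite polyCM; exact: PM.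
Qed.

Lemma const_part_prime : is_prime Q.
Proof. by move=> x y; rewrite /Q /= polyCM; exact: primeP. Qed.

Lemma in_const_part_mem p : QX p -> P p.
Proof.
move=> Qp; rewrite -[p]coefK poly_def; apply: ideal_sum => // i _.
by rewrite -mul_polyC mulrC; case: idP => _ _; apply; exact: Qp.
Qed.

Lemma in_const_partM p q : QX p -> QX (p * q).
Proof.
move=> Qp j; rewrite coefM; apply: (ideal_sum _ const_part_ideal) => i _.
by rewrite mulrC; case: const_part_ideal => _ _; apply; exact: Qp.
Qed.

Lemma in_const_partD p q : QX p -> QX q -> QX (p + q).
Proof.
move=> Qp Qq j; rewrite coefD.
by case: const_part_ideal => _ QD _; apply: QD.
Qed.

Section Minimal.
Variable I : set {poly D}.
Hypotheses (idI : is_ideal I) (PI : P `<=` I).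

(** A leading term with coefficient in [Q] belongs to [P], so removing it does not leave [I]; this
    stops before 0 because [p] is nonzero modulo [Q]. *)
Lemma trim_lead p : I p -> ~ QX p ->
  exists r, [/\ I r, ~ Q (lead_coef r) & (size r <= size p)%N].
Proof.
have [m] := ubnP (size p); elim: m p => // m IHm p ltpm Ip nQp.
have [Ql|nQl] := pselect (Q (lead_coef p)); last by exists p.
have p0 : p != 0.
  by apply: contra_notN nQp => /eqP -> j; rewrite coef0; case: const_part_ideal.
pose t := lead_coef p *: 'X^((size p).-1).
have Qt : QX t.
  move=> j; rewrite coefZ coefXn mulrC; case: const_part_ideal => _ _; exact.
have szt : (size (p - t)%R < size p)%N.
  rewrite -[X in (_ < X)%N](prednK (n := size p)) ?size_poly_gt0 // ltnS.
  apply/leq_sizeP => j; rewrite leq_eqVlt => /orP[/eqP <-|ltj].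
    by rewrite coefB coefZ coefXn eqxx mulr1 subrr.
  rewrite coefB coefZ coefXn gtn_eqF // mulr0 subr0 nth_default //.
  by rewrite -(prednK (n := size p)) // size_poly_gt0.
have [|||r [Ir lr szr]] := IHm (p - t).
- exact: leq_trans szt _.
- by apply: idealB => //; apply: PI; exact: in_const_part_mem.
- by move=> Qpt; apply: nQp; rewrite -(subrK t p); exact: in_const_partD.
by exists r; split=> //; exact: leq_trans szr (ltnW szt).
Qed.

(** A leading coefficient outside [Q] makes pseudo-division by [r] meaningful modulo [Q];
    [trim_lead] then controls all smaller elements of [I]. *)
Lemma minimal_lead p : I p -> ~ QX p ->
  exists r, [/\ I r, ~ Q (lead_coef r) &
    forall t, I t -> (size t < size r)%N -> QX t].
Proof.
move=> Ip nQp.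
pose S m := `[< exists r, [/\ I r, ~ Q (lead_coef r) & size r = m] >].
have exS : exists m, S m.
  have [r [Ir lr _]] := trim_lead Ip nQp.
  by exists (size r); apply/asboolP; exists r.
case: (ex_minnP exS) => m /asboolP[r [Ir lr <-]] rmin; exists r.
split=> // t It.
move=> ltt; apply: contrapT => nQt.
have [r' [Ir' lr' szr']] := trim_lead It nQt.
have := rmin (size r'); rewrite leqNgt (leq_ltn_trans szr' ltt) => H.
by have : false by apply: H; apply/asboolP; exists r'.
Qed.

End Minimal.

(* [q] plays the role of the minimal polynomial of 'X modulo P over Frac (D/Q).
   The elements [q] and [r] of least degree, in P and in P + (b), among those
   with leading coefficient outside Q are found independently; if [r] were not
   constant, dividing [q] and [b] by [r] would contradict primality. *)
Lemma prime_poly_cases b : ~ P b ->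
  (forall p, P p -> QX p) \/
  exists q r0, [/\ P q, ~ Q (lead_coef q),
    forall t, P t -> (size t < size q)%N -> QX t, ~ Q r0 &
    exists2 p, P p & exists c, r0%:P = p + c * b].
Proof.
move=> nPb; have [|/existsNP[q1 /not_implyP[Pq1 nQq1]]] :=
  pselect (forall p, P p -> QX p); first by left.
right; have [q [Pq lq qmin]] := minimal_lead idP (@subset_refl _ P) Pq1 nQq1.
have [P0 PD PM] := idP.
have nP1 : ~ P 1 by move=> P1; apply: nPb; rewrite -[b]mulr1; exact: PM.
have idI := ideal_adjoin b idP.
set I := (X in is_ideal X) in idI.
have PI : P `<=` I.
  by move=> x Px; exists x => //; exists 0; rewrite mul0r addr0.
have Ib : I b by exists 0 => //; exists 1; rewrite mul1r add0r.
have [r [Ir lr rmin]] := minimal_lead idI PI (PI _ Pq1) nQq1.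
have nQX l n : ~ Q l -> ~ Q (l ^+ n).
  by move=> nQl /(primeX const_part_prime); rewrite /Q /= polyC1 => /(_ nP1).
have r0 : r != 0.
  apply: contra_notN lr => /eqP ->; rewrite lead_coef0.
  by case: const_part_ideal.
have [szr|szr] := leqP (size r) 1.
  exists q, (lead_coef r); split=> //.
  have [y Py [c E]] := Ir; exists y => //; exists c; rewrite -E.
  by rewrite lead_coefE [in RHS](size1_polyC szr); case: (size r) szr => [|[]].
exfalso.
(* The remainder of pseudo-division by [r] lies in [I] and is smaller than [r], so it vanishes
   modulo [Q]. *)
have divI f : I f -> exists s t n,
    [/\ lead_coef r ^+ n *: f = s * r + t, QX t &
        (size s = size f - (size r).-1)%N].
  move=> If; exists (f %/ r), (f %% r), (scalp f r).
  split; [exact: divp_eq| |exact: size_divp].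
  apply: rmin; last by rewrite ltn_modp.
  have -> : f %% r = (lead_coef r ^+ scalp f r)%:P * f - (f %/ r) * r.
    by rewrite mul_polyC divp_eq addrAC subrr add0r.
  by apply: idealB => //; case: idI => _ _; apply.
have [s [t [n [E Qt szs]]]] := divI _ (PI _ Pq).
have : P (s * r).
  have -> : s * r = (lead_coef r ^+ n)%:P * q - t by rewrite mul_polyC E addrK.
  apply: idealB => //; [exact: PM|exact: in_const_part_mem].
move=> /primeP[Ps|Pr].
(* As [r] is not constant, [s] is smaller than [q], hence zero modulo [Q]; then so is [q] times a
   power of [lead_coef r], against primality of [Q]. *)
- have Qs : QX s.
    apply: qmin => //; rewrite szs.
    have : q != 0.
      apply: contra_notN lq => /eqP ->; rewrite lead_coef0.
      by case: const_part_ideal.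
    rewrite -size_poly_gt0; case: (size r) szr => [|[|m]] // _ szq.
    by rewrite /= ltn_subrL.
  have := in_const_partD (in_const_partM r Qs) Qt.
  rewrite -E => /(_ (size q).-1).
  by rewrite coefZ => /const_part_prime[|//]; exact: nQX.
- have [s' [t' [m [E' Qt' _]]]] := divI _ Ib.
  have : P ((lead_coef r ^+ m)%:P * b).
    rewrite mul_polyC E'; apply: PD; first exact: PM.
    exact: in_const_part_mem.
  by move=> /primeP[|//]; exact: nQX.
Qed.

End PolynomialStep.

(** * The Nullstellensatz *)

(* The Nullstellensatz for a prime ideal of a k-algebra D, with [i] the
   structure map: k-points of P are dense. *)
Definition enough_points (k : closedFieldType) (D : idomainType)
    (i : {rmorphism k -> D}) : Prop :=
  forall (P : set D) b, is_ideal P -> is_prime P -> ~ P b ->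
  exists phi : {rmorphism D -> k},
    [/\ cancel i phi, forall x, P x -> phi x = 0 & phi b != 0].

Section EnoughPoints.
Variable k : closedFieldType.

Lemma enough_points_field : enough_points (idfun : {rmorphism k -> k}).
Proof.
move=> P b [P0 _ PM] _ nPb.
have Px0 x : P x -> x = 0.
  move=> Px; apply: contra_not_eq nPb => x0.
  by rewrite -(mulfVK x0 b); exact: PM.
by exists idfun; split=> //; apply: contra_not_neq nPb => /= ->.
Qed.

(** A point of [const_part P] extends to [{poly D}] by a choice of value for the variable: a
    non-root of the image of [b] if [P] is generated by constants, otherwise a root of the image of
    [q]. *)
Lemma enough_points_poly (D : idomainType) (i : {rmorphism k -> D}) :
  enough_points i -> enough_points (polyC \o i : {rmorphism k -> {poly D}}).
Proof.
move=> epD P b idP primeP nPb.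
have idQ := const_part_ideal idP; have primeQ := const_part_prime primeP.
have evalE (f : {rmorphism D -> k}) (c : k) : cancel i f ->
    exists psi : {rmorphism {poly D} -> k},
    cancel (polyC \o i) psi /\ forall p, psi p = (map_poly f p).[c].
  move=> fK; exists (horner_morph (fun x => mulrC c (f x))); split=> // x.
  by rewrite /= horner_morphC fK.
have map0 (f : {rmorphism D -> k}) p : (forall x, const_part P x -> f x = 0) ->
    in_const_part P p -> map_poly f p = 0.
  by move=> f0 Qp; apply/polyP => j; rewrite coef_map coef0 /= f0.
have [PQ|[q [r0 [Pq lq qmin nQr0 [y Py [c E]]]]]] :=
    prime_poly_cases idP primeP nPb.
  have /existsNP[j nQbj] : ~ in_const_part P b.
    by move=> Qb; apply: nPb; exact: in_const_part_mem.
  have [f [fK f0 fbj]] := epD _ _ idQ primeQ nQbj.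
  have /closed_nonrootP[c nrc] : map_poly f b != 0.
    by apply: contra_neq fbj => /polyP/(_ j); rewrite coef_map coef0.
  have [psi [psiK psiE]] := evalE f c fK.
  exists psi; split=> // [p Pp|]; rewrite psiE //.
  by rewrite (map0 _ _ f0) ?horner0 //; exact: PQ.
(* Nonvanishing of [lead_coef q] preserves the degree of [q]; nonvanishing of [r0], a multiple of
   [b] modulo [P], forces that of [b]. *)
have nQ : ~ const_part P (lead_coef q * r0) by move=> /primeQ[].
have [f [fK f0]] := epD _ _ idQ primeQ nQ.
rewrite rmorphM mulf_eq0 negb_or => /andP[flq fr0].
have szfq : size (map_poly f q) = size q by apply: size_map_poly_id0.
(* Any root [a] of the image of [q] works: P is contained in the ideal of [q]
   and const_part P, up to a power of the leading coefficient of [q]. *)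
have [a /rootP ra] : exists a, root (map_poly f q) a.
  apply/closed_rootP; rewrite szfq; apply: contra_notN lq => /eqP sz1.
  rewrite /const_part /= lead_coefE sz1 /=.
  by rewrite -(@size1_polyC _ q) ?sz1.
have [psi [psiK psiE]] := evalE f a fK.
have psi0 p : P p -> psi p = 0.
  move=> Pp; have := congr1 psi (divp_eq p q).
  have Pt : P (p %% q).
    have -> : p %% q = (lead_coef q ^+ scalp p q)%:P * p - (p %/ q) * q.
      by rewrite mul_polyC divp_eq addrAC subrr add0r.
    by apply: idealB => //; case: idP => _ _; apply.
  have q0 : q != 0.
    by apply: contra_notN lq => /eqP ->; rewrite lead_coef0; case: idQ.
  have Qt : in_const_part P (p %% q) by apply: qmin => //; rewrite ltn_modp.
  have flq' : f (lead_coef q ^+ scalp p q) != 0.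
    by rewrite rmorphXn expf_neq0.
  rewrite -mul_polyC rmorphD !rmorphM /= [psi q]psiE ra mulr0 add0r.
  rewrite [psi (p %% q)]psiE (map0 _ _ f0 Qt) horner0 psiE map_polyC hornerC.
  by move=> /eqP; rewrite mulf_eq0 (negbTE flq') => /eqP.
exists psi; split=> //.
have := congr1 psi E; rewrite rmorphD rmorphM (psi0 y Py) add0r.
rewrite psiE map_polyC hornerC /= => fE.
by apply: contra_neq fr0 => pb; rewrite fE pb mulr0.
Qed.

(** Each element of [s] costs one polynomial variable, which [ev] sends to it; a finitely generated
    algebra thus becomes a quotient of a domain with enough points. *)
Lemma enough_points_cover (A : comNzRingType) (j : {rmorphism k -> A})
    (s : seq A) :
  exists (D : idomainType) (i : {rmorphism k -> D}) (ev : {rmorphism D -> A}),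
  [/\ enough_points i, forall c, ev (i c) = j c &
      forall x, x \in s -> exists t, ev t = x].
Proof.
elim: s => [|x s [D [i [ev [epD evi evs]]]]].
  by exists k, idfun, j; split=> //; exact: enough_points_field.
pose ev' : {rmorphism {poly D} -> A} := horner_morph (fun z => mulrC x (ev z)).
have ev'C d : ev' d%:P = ev d by exact: horner_morphC.
exists {poly D}, (polyC \o i), ev'; split.
- exact: enough_points_poly.
- by move=> c; rewrite /= ev'C evi.
- move=> z; rewrite inE => /orP[/eqP ->|/evs[t <-]].
    by exists 'X; exact: horner_morphX.
  by exists t%:P.
Qed.

End EnoughPoints.

(** A prime containing [I] and avoiding [u] is pulled back to an iterated polynomial ring mapping
    onto [A]; a point of the pullback kills the kernel of [ev], hence descends to [A]. *)
Lemma nullstellensatz (k : closedFieldType) (A : algebra k) (I : set A)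
    (u : A) :
  finitely_generated A -> is_ideal I -> (forall n, ~ I (u ^+ n)) ->
  exists phi : {rmorphism A -> k},
    [/\ forall c, phi (alg_const A c) = c, forall x, I x -> phi x = 0 &
        phi u != 0].
Proof.
move=> [s gens] idI /(prime_avoiding_powers idI)[P [idP primeP IP nPu]].
have one0 : (1 : A) != 0.
  apply: contra_notN nPu => /eqP E; rewrite -[u]mulr1 E mulr0.
  by case: idP.
pose B : comNzRingType := HB.pack (GRing.ComPzRing.sort A)
  (GRing.PzSemiRing_isNonZero.Build A one0).
have [D [i [ev [epD evi evs]]]] :=
  @enough_points_cover k B (alg_const A) s.
have evT x : exists t, ev t = x.
  have -> // : (exists t, ev t = x) = [set: A] x.
  rewrite -(gens [set x | exists t, ev t = x]) //; split.
  - by move=> c; exists (i c).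
  - by move=> _ _ [t <-] [t' <-]; exists (t + t'); rewrite rmorphD.
  - by move=> _ _ [t <-] [t' <-]; exists (t * t'); rewrite rmorphM.
have /choice[h hK] := evT.
have [|||f [fK f0 fu]] := epD [set t | P (ev t)] (h u).
- have [P0 PD PM] := idP; split=> /=.
  + by rewrite rmorph0.
  + by move=> x y; rewrite rmorphD; exact: PD.
  + by move=> a x; rewrite rmorphM; exact: PM.
- by move=> x y; rewrite /= rmorphM => /primeP.
- by rewrite /= hK.
(* [h] is only a set-theoretic section of [ev]; independence of the chosen preimage makes [f \o h] a
   ring morphism. *)
have fh t : f (h (ev t)) = f t.
  apply/eqP; rewrite -subr_eq0 -rmorphB f0 //= rmorphB hK subrr.
  by case: idP.
pose g (x : A) := f (h x).
have gB : zmod_morphism g.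
  by move=> x y; rewrite /g -rmorphB -[RHS]fh rmorphB !hK.
have gM : monoid_morphism g.
  by split=> [|x y]; rewrite /g; [rewrite -(rmorph1 f) -[RHS]fh rmorph1|
    rewrite -rmorphM -[RHS]fh rmorphM !hK].
pose gR : {rmorphism A -> k} := HB.pack g
  (GRing.isZmodMorphism.Build A k g gB) (GRing.isMonoidMorphism.Build A k g gM).
exists gR; split.
- by move=> c; rewrite /= /g -evi fh fK.
- by move=> x /IP Px; apply: f0; rewrite /= hK.
- exact: fu.
Qed.

(** * Free modules over a rational algebra as equivariant modules *)

Section PowerModule.
Variables (k : closedFieldType) (G : affineAlgebraicGroup k).
Variables (R : rational_algebra G) (n : nat).
Local Notation M := ('rV[R]_n : lmodType R).
Local Notation V := (restrict_scalars M).

Lemma ra_act_linear g (c : k) (r s : R) :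
  ra_act g (alg_const R c * r + s) = alg_const R c * ra_act g r + ra_act g s.
Proof. exact: (rational_linear (ra_rational R) g c r s). Qed.

Lemma ra_actD g : {morph @ra_act _ _ R g : r s / r + s}.
Proof.
by move=> r s; have := ra_act_linear g 1 r s; rewrite rmorph1 !mul1r.
Qed.

Lemma ra_act0 g : ra_act g (0 : R) = 0.
Proof. by apply: (addrI (ra_act g 0)); rewrite -ra_actD !addr0. Qed.

Definition power_act (g : G) (v : 'rV[R]_n) : 'rV[R]_n := map_mx (ra_act g) v.

Lemma power_act_linear g (c : k) (u v : V) :
  power_act g (c *: u + v) = c *: (power_act g u : V) + power_act g v.
Proof.
by apply/rowP => j; rewrite !restrict_scaleE !mxE; exact: ra_act_linear.
Qed.

Lemma power_act1 (v : V) : power_act 1%g v = v.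
Proof. by apply/rowP => j; rewrite mxE (rational1 (ra_rational R)). Qed.

Lemma power_actM g h (v : V) :
  power_act (g * h)%g v = power_act g (power_act h v).
Proof. by apply/rowP => j; rewrite !mxE (rationalM (ra_rational R)). Qed.

Lemma power_actZ g (r : R) (v : M) :
  power_act g (r *: v) = ra_act g r *: power_act g v.
Proof. by apply/rowP => j; rewrite !mxE ra_actM. Qed.

Lemma power_actD g (u v : V) :
  power_act g (u + v) = power_act g u + power_act g v.
Proof. by apply/rowP => j; rewrite !mxE ra_actD. Qed.

(** Finiteness without linear independence is visibly stable under sums; [rational_finiteI] recovers
    the full condition. *)
Definition regular_orbit_map (v : V) : Prop :=
  exists s : seq (V * (G -> k)),
    all (fun p => `[< global_functions p.2 >]) s /\
    forall g, power_act g v = \sum_(p <- s) p.2 g *: p.1.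

Lemma regular_orbit_mapD u v :
  regular_orbit_map u -> regular_orbit_map v -> regular_orbit_map (u + v).
Proof.
move=> [s [gs Es]] [t [gt Et]]; exists (s ++ t).
by rewrite all_cat gs gt; split=> // g; rewrite power_actD Es Et big_cat.
Qed.

(** [G] fixes the standard basis vectors, so the matrix coefficients of a finite-dimensional stable
    subspace containing [r] suffice. *)
Lemma regular_orbit_map_delta r j :
  regular_orbit_map (r *: (delta_mx 0 j : M)).
Proof.
have [m [e [c [_ [a ra] gc rho_e]]]] := rational_finite (ra_rational R) r.
exists [seq ((e i : R) *: (delta_mx 0 j : M), fun g => \sum_l a l * c i l g) |
  i <- enum 'I_m]; split.
  rewrite all_map; apply/allP => i _; apply/asboolP => /=.
  by apply: global_sum => l; exact: gc.
move=> g; rewrite big_map big_enum /=.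
have -> : power_act g (r *: (delta_mx 0 j : M)) =
    ra_act g r *: (delta_mx 0 j : M).
  rewrite power_actZ; congr (_ *: _); apply/rowP => l; rewrite !mxE.
  by case: (_ && _); [exact: ra_act1|exact: ra_act0].
have -> : ra_act g r = \sum_i alg_const R (\sum_l a l * c i l g) * e i.
  rewrite [in LHS]ra (rho_sum (rational_linear (ra_rational R))).
  under eq_bigr do rewrite rho_e scaler_sumr.
  rewrite exchange_big /=; apply: eq_bigr => i _.
  rewrite rmorph_sum mulr_suml; apply: eq_bigr => l _.
  by rewrite scalerA restrict_scaleE.
rewrite scaler_suml; apply: eq_bigr => i _.
by rewrite restrict_scaleE scalerA.
Qed.

Lemma power_act_rational : @is_rational k G V power_act.
Proof.
split; [exact: power_act_linear|exact: power_act1|exact: power_actM|move=> v].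
have [s [gs Es]] : regular_orbit_map v.
  rewrite (row_sum_delta (v : 'rV[R]_n)); apply: big_ind.
  - exists [::]; split=> // g; rewrite big_nil.
    by apply/rowP => j; rewrite !mxE ra_act0.
  - exact: regular_orbit_mapD.
  - by move=> j _; exact: regular_orbit_map_delta.
apply: (rational_finiteI power_act_linear power_act1 power_actM
  (e := fun i : 'I_(size s) => (tnth (in_tuple s) i).1)
  (f := fun i => (tnth (in_tuple s) i).2)).
  by move=> i; apply/asboolP; apply: (allP gs); exact: mem_tnth.
by move=> g; rewrite Es big_tnth.
Qed.

Definition power_module : GR_module R :=
  GRModule power_act_rational power_actZ.

End PowerModule.

(** * Making the coefficients of a combination invariant *)

Section InvariantLift.
Variables (k : closedFieldType) (G : affineAlgebraicGroup k).
Variables (R : rational_algebra G) (J : zmodClosed R).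
Hypothesis stableJ : is_stable_ideal J.
Local Notation quotJ := (Quotient.quot J).

Lemma quot_eq (x y : R) : x - y \in J -> (\pi_quotJ x = \pi_quotJ y)%qT.
Proof. by rewrite Quotient.idealrBE => /eqP. Qed.

Lemma quot_eqP (x y : R) : (\pi_quotJ x = \pi_quotJ y)%qT -> x - y \in J.
Proof. by move=> E; rewrite Quotient.idealrBE E. Qed.

Lemma repr_mem (x : R) : repr (\pi_quotJ x)%qT - x \in J.
Proof. by apply: quot_eqP; rewrite reprK. Qed.

Lemma quot_scaleE r (x : R) :
  quot_scale r (\pi_quotJ x)%qT = (\pi_quotJ (r * x))%qT.
Proof.
by apply: quot_eq; rewrite -mulrBr; apply: stableJ.1; exact: repr_mem.
Qed.

Lemma ra_actB g (r s : R) : ra_act g (r - s) = ra_act g r - ra_act g s.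
Proof. by apply: (addIr (ra_act g s)); rewrite -ra_actD !subrK. Qed.

Lemma ra_act_sum g (n : nat) (f : 'I_n -> R) :
  ra_act g (\sum_i f i) = \sum_i ra_act g (f i).
Proof. exact: (big_morph _ (ra_actD g) (ra_act0 _ g)). Qed.

Lemma quot_actE g (x : R) :
  quot_act g (\pi_quotJ x)%qT = (\pi_quotJ (ra_act g x))%qT.
Proof.
by apply: quot_eq; rewrite -ra_actB; apply: stableJ.2; exact: repr_mem.
Qed.

(* Linear reductivity applied to the free module R^n, mapped to R / J by a row
   of elements of R whose classes modulo J are invariant. *)
Lemma invariant_combination (n : nat) (u f : 'I_n -> R) :
  linearly_reductive R ->
  (forall g i, ra_act g (u i) - u i \in J) ->
  \sum_i f i * u i - 1 \in J ->
  exists2 m : 'I_n -> R, forall i, fixed_points (@ra_act _ _ R) (m i) &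
    \sum_i m i * u i - 1 \in J.
Proof.
move=> lrR uJ fu.
pose lambda (v : power_module R n) : quotJ :=
  (\pi_quotJ (\sum_i (v : 'rV[R]_n) 0%R i * u i))%qT.
have lambdaZ r m : lambda (r *: m) = quot_scale r (lambda m).
  rewrite quot_scaleE /lambda mulr_sumr; congr (\pi _)%qT.
  by apply: eq_bigr => i _; rewrite mxE mulrA.
have [||m fix_m /quot_eqP mJ] := lrR (power_module R n) J lambda stableJ.
- split=> // [v w|g v].
  + rewrite /lambda -(raddfD (\pi_quotJ)%qT) -big_split /=; congr (\pi _)%qT.
    by apply: eq_bigr => i _; rewrite mxE mulrDl.
  (* Equivariance holds only in the quotient, as the [u i] are invariant modulo [J]. *)
  + rewrite quot_actE; apply: quot_eq.
    rewrite ra_act_sum -sumrB; apply: rpred_sum => i _.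
    rewrite mxE ra_actM -mulrBr; apply: stableJ.1.
    by rewrite -opprB rpredN.
- apply/seteqP; split=> // x _.
  exists (repr x *: (\row_i f i : 'rV[R]_n)) => //.
  rewrite lambdaZ quot_scaleE -[RHS]reprK; apply: quot_eq.
  under eq_bigr do rewrite mxE.
  by rewrite -[X in _ - X]mulr1 -mulrBr; exact: stableJ.1.
exists (fun i => (m : 'rV[R]_n) 0 i) => // i g.
by have /rowP/(_ i) := fix_m g; rewrite mxE.
Qed.

End InvariantLift.

(** * Functions on affine varieties *)

Section Evaluation.
Variables (k : closedFieldType) (X : spaceWithFunctions k).

Definition eval_at (x : X) (f : coord_algebra X) : k :=
  val (f : coord_ring X) x.

Lemma eval_at_is_zmod_morphism x : zmod_morphism (eval_at x).
Proof. by []. Qed.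

Lemma eval_at_is_monoid_morphism x : monoid_morphism (eval_at x).
Proof. by []. Qed.

HB.instance Definition _ x := GRing.isZmodMorphism.Build (coord_algebra X) k
  (eval_at x) (eval_at_is_zmod_morphism x).
HB.instance Definition _ x := GRing.isMonoidMorphism.Build (coord_algebra X) k
  (eval_at x) (eval_at_is_monoid_morphism x).

Lemma eval_at_const x c : eval_at x (alg_const (coord_algebra X) c) = c.
Proof. by []. Qed.

Lemma eval_at_inj (f g : coord_algebra X) :
  (forall x, eval_at x f = eval_at x g) -> f = g.
Proof. by move=> fg; apply/val_inj/funext. Qed.

Lemma eval_at_global (f : coord_algebra X) : global_functions (eval_at^~ f).
Proof. by have /= := valP (f : coord_ring X); rewrite inE. Qed.

Lemma coord_of_global (f : X -> k) : global_functions f ->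
  exists g : coord_algebra X, forall x, eval_at x g = f x.
Proof. by rewrite -inE => gf; exists (exist _ f gf : coord_ring X). Qed.

Lemma global_nonzero_open (f : X -> k) : global_functions f ->
  open [set x | f x != 0].
Proof. by move=> /(regular_inv _ _ openT)[]; rewrite setTI. Qed.

Lemma global_zero_closed (f : X -> k) : global_functions f ->
  closed [set x | f x = 0].
Proof.
move=> /global_nonzero_open; rewrite -closedC.
by congr closed; apply/seteqP; split=> x /=; [move=> /negP/negPn/eqP|
  move=> ->; rewrite eqxx].
Qed.

(** The ideal of [W], boolean so that it can be packed as a [zmodClosed]. *)
Definition vanishing_on (W : set X) : {pred coord_algebra X} :=
  [pred f | `[< forall x, W x -> eval_at x f = 0 >]].

Lemma vanishing_onP W f :
  reflect (forall x, W x -> eval_at x f = 0) (f \in vanishing_on W).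
Proof. exact: asboolP. Qed.

Lemma vanishing_on_zmod_closed W : zmod_closed (vanishing_on W).
Proof.
split=> [|f g /vanishing_onP f0 /vanishing_onP g0]; apply/vanishing_onP => x Wx.
  exact: rmorph0.
by rewrite rmorphB /= f0 ?g0 ?subrr.
Qed.

HB.instance Definition _ W := GRing.isZmodClosed.Build (coord_algebra X)
  (vanishing_on W) (vanishing_on_zmod_closed W).

Hypothesis affX : is_affine X.

Lemma affine_point_inj (x y : X) :
  (forall f, eval_at x f = eval_at y f) -> x = y.
Proof.
have [z [_ zuniq]] := affine_points affX (phi := eval_at x) (eval_at_const x).
move=> xy.
by rewrite -(zuniq x) // -(zuniq y).
Qed.

Lemma affine_nullstellensatz (I : set (coord_algebra X)) u :
  is_ideal I -> (forall n, ~ I (u ^+ n)) ->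
  exists x, (forall f, I f -> eval_at x f = 0) /\ eval_at x u != 0.
Proof.
move=> idI uI.
have [phi [phiC phi0 phiu]] := nullstellensatz (affine_fg affX) idI uI.
have [x [xE _]] := affine_points affX phiC.
exists x; split=> [f /phi0|]; first by rewrite (xE f).
by rewrite -[eval_at x u](xE u).
Qed.

Lemma affine_ideal_one (I : set (coord_algebra X)) :
  is_ideal I -> (forall x, exists2 f, I f & eval_at x f != 0) -> I 1.
Proof.
move=> idI nz; apply: contrapT => I1.
have [n|x [x0 _]] := @affine_nullstellensatz I 1 idI; first by rewrite expr1n.
by have [f /x0 ->] := nz x; rewrite eqxx.
Qed.

Lemma affine_separate (C : set X) x : closed C -> ~ C x ->
  exists2 w, eval_at x w != 0 & forall y, C y -> eval_at y w = 0.
Proof.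
move=> /(affine_closed affX)[S gS ->] /existsNP[f /not_implyP[Sf /eqP fx]].
have [w wE] := coord_of_global (gS _ Sf); exists w; first by rewrite wE.
by move=> y Cy; rewrite wE; exact: Cy.
Qed.

(** The denominators of [f] on the basic open set of [u] form an ideal. Local fractions show that it
    has no zero there, so it contains a power of [u]. *)
Lemma regular_basic_open (U : set X) (f : X -> k) (u : coord_algebra X) :
  open U -> regular U f -> (forall x, eval_at x u != 0 -> U x) ->
  exists n g, forall x, eval_at x u != 0 ->
    eval_at x u ^+ n * f x = eval_at x g.
Proof.
move=> oU /(affine_regular affX _ oU) Uf uU.
pose I := [set d : coord_algebra X | exists g, forall x, eval_at x u != 0 ->
  eval_at x d * f x = eval_at x g].
have idI : is_ideal I.
  split.
  - by exists 0 => x _; rewrite !rmorph0 mul0r.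
  - move=> d e [g gE] [h hE]; exists (g + h) => x ux.
    by rewrite !rmorphD /= mulrDl gE // hE.
  - move=> b d [g gE]; exists (b * g) => x ux.
    by rewrite !rmorphM /= -mulrA gE.
apply: contrapT => nE.
have [|x [x0 ux]] := @affine_nullstellensatz I u idI.
  move=> n [g gE]; apply: nE; exists n, g => x ux.
  by rewrite -rmorphXn gE.
have [V [p [q [oV Vx VU [gp gq] fE]]]] := Uf _ (uU _ ux).
have [pR pE] := coord_of_global gp; have [qR qE] := coord_of_global gq.
have [|//|w wx w0] := @affine_separate (~` V) x; first exact: open_closedC.
(* The factor [w] vanishes off [V], which turns the local denominator into one valid on the whole
   basic open set. *)
have /eqP : eval_at x (w * qR) = 0.
  apply: x0; exists (w * pR) => y uy; rewrite !rmorphM /= qE pE.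
  have [Vy|/w0 ->] := pselect (V y); last by rewrite !mul0r.
  by have [qy ->] := fE _ Vy; rewrite -mulrA [q y * _]mulrC divfK.
by rewrite rmorphM /= mulf_eq0 (negbTE wx) qE (negbTE (fE _ Vx).1).
Qed.

End Evaluation.

Arguments eval_at {k X} x f.

(** * The quotient map and its properties *)

Section AffineQuotient.
Variables (k : closedFieldType) (G : affineAlgebraicGroup k).
Variables (X : spaceWithFunctions k) (affX : is_affine X).
Variables (a : regular_action G X).
Variables (Y : spaceWithFunctions k) (affY : is_affine Y).
Variables (phi : {rmorphism coord_algebra Y -> coord_algebra X}).
Hypothesis invY : is_iso_onto_invariants a phi.
Variables (p : X -> Y) (p_phi : has_comorphism phi p).
Local Notation R := (coord_rational_algebra a).

Lemma eval_comorphism h x : eval_at x (phi h) = eval_at (p x) h.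
Proof. by rewrite /eval_at p_phi. Qed.

Lemma comorphism_fixed h g : coord_act a g (phi h) = phi h.
Proof. by have [_ [fun_phi _ _]] := invY; exact: (fun_phi h). Qed.

Lemma fixed_comorphism f : fixed_points (coord_act a) f -> exists h, phi h = f.
Proof.
by have [_ [_ _ surj_phi]] := invY => /surj_phi[h _ <-]; exists h.
Qed.

Lemma quotient_orbits x g : p (a x g) = p x.
Proof.
apply: (affine_point_inj affY) => h.
by rewrite -!eval_comorphism -[in RHS](comorphism_fixed h g).
Qed.

Lemma fixed_eval (f : coord_algebra X) x y :
  fixed_points (coord_act a) f -> p x = p y -> eval_at x f = eval_at y f.
Proof.
by move=> /fixed_comorphism[h <-] pxy; rewrite !eval_comorphism pxy.
Qed.

Lemma global_comp (f : Y -> k) :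
  global_functions f -> global_functions (f \o p).
Proof.
move=> /coord_of_global[h hE].
have -> : f \o p = eval_at^~ (phi h).
  by apply/funext => x; rewrite eval_comorphism hE.
exact: eval_at_global.
Qed.

Lemma quotient_continuous : continuous p.
Proof.
apply/continuous_closedP => C /(affine_closed affY)[S gS ->].
apply/(affine_closed affX); exists [set f \o p | f in S].
  by move=> _ [f Sf <-]; apply: global_comp; exact: gS.
apply/seteqP; split=> [x Cx _ [f Sf <-]|x Cx f Sf]; first exact: Cx.
by apply: (Cx (f \o p)); exists f.
Qed.

Lemma quotient_morphism : is_morphism p.
Proof.
split=> [|V s oV /(affine_regular affY _ oV) Vs].
  exact: quotient_continuous.
have cp W : open W -> open (p @^-1` W).
  by move: W; apply/continuousP; exact: quotient_continuous.
apply/(affine_regular affX _ (cp _ oV)) => x /Vs[W [f [g [oW Wx WV [gf gg] E]]]].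
exists (p @^-1` W), (f \o p), (g \o p); split=> //.
- exact: cp.
- by move=> y /WV.
- by split; exact: global_comp.
- by move=> y /E.
Qed.

Lemma affine_variety : is_variety Y.
Proof.
split.
  exists 1%N, (fun=> Y), (fun _ => id); split.
    move=> _; split=> //; split=> //.
    + by move=> W; rewrite image_id.
    + by move=> W f oW; rewrite image_id.
  by apply/seteqP; split=> // y _; exists ord0 => //; exists y.
move=> Z q r _ [_ qm] [_ rm].
have gq (s : Z -> Y) :
    (forall (V : set Y) (f : Y -> k), open V -> regular V f ->
      regular (s @^-1` V) (f \o s)) ->
    forall h : coord_algebra Y, exists f : coord_algebra Z,
      forall z, eval_at z f = eval_at (s z) h.
  move=> sm h; apply: (@coord_of_global _ _ (fun z => eval_at (s z) h)).
  exact: (sm setT _ openT (eval_at_global h)).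
(* Functions separate the points of [Y], so the agreement locus is cut out by global functions on
   [Z]. *)
have -> : [set z | q z = r z] = \bigcap_(h in [set: coord_algebra Y])
    [set z | eval_at (q z) h = eval_at (r z) h].
  apply/seteqP; split=> [z qr h _|z qr]; first by rewrite /= qr.
  by apply: (affine_point_inj affY) => h; exact: qr.
apply: closed_bigI => h _.
have [f fE] := gq q qm h; have [g gE] := gq r rm h.
have -> : [set z | eval_at (q z) h = eval_at (r z) h] =
    [set z | eval_at z (f - g) = 0].
  apply/seteqP; split=> z /=; rewrite rmorphB /= fE gE.
    by move=> ->; rewrite subrr.
  by move/eqP; rewrite subr_eq0 => /eqP.
exact/global_zero_closed/eval_at_global.
Qed.

Hypothesis lrX : linearly_reductive_action a.

Lemma vanishing_stable W : stable a W ->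
  is_stable_ideal (vanishing_on W : zmodClosed R).
Proof.
move=> stW; split=> [r f /vanishing_onP f0|g f /vanishing_onP f0];
  apply/vanishing_onP => x Wx.
- by rewrite rmorphM /= f0 ?mulr0.
- by have := f0 _ (stW x g Wx).
Qed.

Lemma invariant_combination_on W n (u f : 'I_n -> coord_algebra X) :
  stable a W ->
  (forall g i x, W x -> eval_at (a x g) (u i) = eval_at x (u i)) ->
  (forall x, W x -> \sum_i eval_at x (f i) * eval_at x (u i) = 1) ->
  exists2 m : 'I_n -> coord_algebra X,
    forall i, fixed_points (coord_act a) (m i) &
    forall x, W x -> \sum_i eval_at x (m i) * eval_at x (u i) = 1.
Proof.
move=> stW uW fW.
have sumE x (g : 'I_n -> coord_algebra X) :
    eval_at x (\sum_i g i * u i - 1) =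
    \sum_i eval_at x (g i) * eval_at x (u i) - 1.
  by rewrite rmorphB rmorph1 rmorph_sum.
have [||m fix_m mW] :=
  @invariant_combination k G R _ (vanishing_stable stW) n u f lrX.
- move=> g i; apply/vanishing_onP => x Wx; rewrite rmorphB /=.
  by apply/eqP; rewrite subr_eq0; apply/eqP; exact: uW.
- by apply/vanishing_onP => x Wx; rewrite sumE fW // subrr.
exists m => // x Wx; apply/eqP; rewrite -subr_eq0 -sumE; apply/eqP.
by move/vanishing_onP: mW; exact.
Qed.

Lemma quotient_image W y : closed W -> stable a W ->
  (forall h, (forall x, W x -> eval_at (p x) h = 0) -> eval_at y h = 0) ->
  (p @` W) y.
Proof.
move=> clW stW yW; apply: contrapT => nWy.
(* The sum of the ideal of [W] and the ideal generated by pullbacks of functions vanishing at [y];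
   lists encode the finite combinations. *)
pose I := [set d : coord_algebra X |
  exists s : seq (coord_algebra X * coord_algebra Y),
  all (fun q => eval_at y q.2 == 0) s /\
  d - \sum_(q <- s) q.1 * phi q.2 \in vanishing_on W].
have idI : is_ideal I.
  split.
  - by exists [::]; split=> //; rewrite big_nil subrr rpred0.
  - move=> d e [s [ys ds]] [t [yt et]]; exists (s ++ t).
    by rewrite all_cat ys yt big_cat opprD addrACA; split=> //; exact: rpredD.
  - move=> b d [s [ys ds]]; exists [seq (b * q.1, q.2) | q <- s].
    rewrite all_map; split=> //; rewrite big_map.
    under eq_bigr do rewrite /= -mulrA.
    by rewrite -mulr_sumr -mulrBr; apply: (vanishing_stable stW).1.
have [|s [ys sW]] := affine_ideal_one affX idI.
  (* On [W], a function separating [p x] from [y] is shifted to vanish at [y]; off [W], a function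
     vanishing on [W] is taken. *)
  move=> x; have [Wx|/(affine_separate affX clW)[w wx wW]] := pselect (W x).
    have [h] : exists h, eval_at (p x) h != eval_at y h.
      apply: contrapT => /forallNP nE; apply: nWy; exists x => //.
      apply: (affine_point_inj affY) => h.
      by apply/eqP/negP => /negP; exact: nE.
    rewrite -subr_eq0 => hy.
    pose h' := h - alg_const _ (eval_at y h).
    exists (phi h'); last by rewrite eval_comorphism rmorphB.
    exists [:: (1, h')]; rewrite /= big_seq1 mul1r subrr rpred0 andbT.
    by rewrite rmorphB /= eval_at_const subrr.
  exists w => //; exists [::]; split=> //.
  by rewrite big_nil subr0; exact/vanishing_onP.
pose q := tnth (in_tuple s).
have [|||m fix_m mW] := @invariant_combination_on W (size s)
    (fun i => phi (q i).2) (fun i => (q i).1).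
- exact: stW.
- by move=> g i x _; rewrite !eval_comorphism quotient_orbits.
- move=> x Wx; have /vanishing_onP/(_ x Wx) := sW.
  rewrite rmorphB rmorph1 /= => /eqP; rewrite subr_eq0 => /eqP ->.
  rewrite [in RHS]big_tnth rmorph_sum.
  by apply: eq_bigr => i _; rewrite rmorphM.
have /choice[m' m'E] := fun i => fixed_comorphism (fix_m i).
(* This function vanishes on the image of [W], hence at [y] by hypothesis, yet its value there is -1
   since each [(q i).2] vanishes at [y]. *)
have : eval_at y (\sum_i m' i * (q i).2 - 1) = 0.
  apply: yW => x Wx; apply/eqP.
  rewrite rmorphB rmorph1 subr_eq0 -(mW x Wx) rmorph_sum; apply/eqP.
  by apply: eq_bigr => i _; rewrite -m'E !eval_comorphism rmorphM.
rewrite rmorphB rmorph1 rmorph_sum big1 ?sub0r => [/eqP|i _].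
  by rewrite oppr_eq0 oner_eq0.
by rewrite rmorphM /= (eqP (allP ys _ (mem_tnth i (in_tuple s)))) mulr0.
Qed.

Lemma quotient_surjective : range p = [set: Y].
Proof.
apply/seteqP; split=> // y _; apply: quotient_image => //.
(* A function vanishing on the image of [X] pulls back to zero, and [phi] is injective. *)
move=> h h0; suff -> : h = 0 by rewrite rmorph0.
have [_ [_ inj_phi _]] := invY; apply: inj_phi; rewrite ?in_setT //.
apply: eval_at_inj => x; rewrite eval_comorphism h0 //.
by rewrite !rmorph0.
Qed.

Lemma quotient_closed W : closed W -> stable a W -> closed (p @` W).
Proof.
move=> clW stW; apply/(affine_closed affY).
exists [set f | global_functions f /\ forall x, W x -> f (p x) = 0].
  by move=> f [].
apply/seteqP; split=> [_ [x Wx <-] f [_]|y yW]; first exact.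
apply: quotient_image => // h hW; apply: (yW (eval_at^~ h)).
by split=> //; exact: eval_at_global.
Qed.

Lemma quotient_disjoint W1 W2 : closed W1 -> stable a W1 -> closed W2 ->
  stable a W2 -> W1 `&` W2 = set0 -> p @` W1 `&` p @` W2 = set0.
Proof.
move=> cl1 st1 cl2 st2 W12.
(* By disjointness and the Nullstellensatz the ideals of [W1] and [W2] are comaximal. *)
pose I := [set d : coord_algebra X | exists f1 f2,
  [/\ f1 \in vanishing_on W1, f2 \in vanishing_on W2 & d = f1 + f2]].
have idI : is_ideal I.
  split.
  - by exists 0, 0; rewrite !rpred0 addr0.
  - move=> _ _ [f1 [f2 [v1 v2 ->]]] [g1 [g2 [w1 w2 ->]]].
    by exists (f1 + g1), (f2 + g2); rewrite addrACA; split=> //; exact: rpredD.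
  - move=> b _ [f1 [f2 [v1 v2 ->]]]; exists (b * f1), (b * f2).
    by rewrite mulrDr; split=> //; apply: (vanishing_stable _).1.
have [|f1 [f2 [/vanishing_onP v1 /vanishing_onP v2 E]]] :=
    affine_ideal_one affX idI.
  move=> x; have [W1x|/(affine_separate affX cl1)[w wx w0]] := pselect (W1 x).
    have [W2x|/(affine_separate affX cl2)[w wx w0]] := pselect (W2 x).
      by have : (W1 `&` W2) x by []; rewrite W12.
    exists w => //; exists 0, w; rewrite rpred0 add0r; split=> //.
    exact/vanishing_onP.
  exists w => //; exists w, 0; rewrite rpred0 addr0; split=> //.
  exact/vanishing_onP.
have sum1 x : eval_at x f1 + eval_at x f2 = 1 by rewrite -rmorphD -E rmorph1.
have on1 x : W1 x -> eval_at x f2 = 1.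
  by move=> Wx; rewrite -(sum1 x) v1 ?add0r.
have on2 x : W2 x -> eval_at x f1 = 1.
  by move=> Wx; rewrite -(sum1 x) (v2 x) ?addr0.
have [c] : exists c : k, ~~ root ('X * ('X - 1)) c.
  apply/closed_nonrootP; rewrite mulf_neq0 ?polyX_eq0 //.
  by rewrite -polyC1 polyXsubC_eq0.
rewrite rootM rootX -polyC1 root_XsubC negb_or => /andP[c0 c1].
(* c f1 + f2 equals 1 on W1 and c on W2, hence is invertible on W1 `|` W2; an
   invariant inverse separates W1 from W2 because c != 1. *)
pose const c := alg_const (coord_algebra X) c.
have [||x|m fix_m mW] := @invariant_combination_on (W1 `|` W2) 1
    (fun=> const c * f1 + f2) (fun=> const c^-1 * f1 + f2).
- by move=> x g [/st1|/st2]; [left|right].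
- move=> g _ x; rewrite !rmorphD !rmorphM /= !eval_at_const => -[Wx|Wx].
    by rewrite !v1 ?on1 //; exact: st1.
  by rewrite !v2 ?on2 //; exact: st2.
- rewrite big_ord1 !rmorphD !rmorphM /= !eval_at_const => -[Wx|Wx].
    by rewrite !v1 ?on1 // !mulr0 !add0r mulr1.
  by rewrite !v2 ?on2 // !addr0 !mulr1 mulVf.
apply/seteqP; split=> // _ [[x1 Wx1 <-] [x2 Wx2 p12]].
(* The invariant takes one value at both points, but it is 1 on [W1] and [c^-1] on [W2]. *)
have m12 := fixed_eval (fix_m ord0) p12.
have := mW x1 (or_introl Wx1); have := mW x2 (or_intror Wx2).
rewrite !big_ord1 !rmorphD !rmorphM /= !eval_at_const m12.
rewrite (v1 x1) // (on1 x1) // (v2 x2) // (on2 x2) // mulr0 add0r addr0 !mulr1.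
by move=> E1 E2; move: E1; rewrite E2 mul1r => /eqP; rewrite (negbTE c1).
Qed.

Lemma invariant_fraction (U : set X) (f : X -> k) h :
  open U -> invariant_functions a U f ->
  (forall x, eval_at (p x) h != 0 -> U x) ->
  exists n h', forall x, eval_at (p x) h != 0 ->
    f x = eval_at (p x) h' / eval_at (p x) h ^+ n.
Proof.
move=> oU [Uf invf] hU.
have hU' x : eval_at x (phi h) != 0 -> U x.
  by rewrite eval_comorphism; exact: hU.
have [n [g gE]] := regular_basic_open affX oU Uf hU'.
(* phi h * g vanishes where phi h does, so it is invariant on all of X. *)
have [|h' h'E] := @fixed_comorphism (phi h * g).
  move=> s; apply: eval_at_inj => x.
  change (eval_at (a x s) (phi h * g) = eval_at x (phi h * g)).
  rewrite !rmorphM /=.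
  have hxs : eval_at (a x s) (phi h) = eval_at x (phi h).
    by rewrite !eval_comorphism quotient_orbits.
  have [hx|hx] := eqVneq (eval_at x (phi h)) 0; first by rewrite hxs hx !mul0r.
  by rewrite -!gE ?hxs // invf //; exact: hU'.
(* The extra factor [phi h] raises the exponent by one. *)
exists n.+1, h' => x hx.
have hx' : eval_at x (phi h) != 0 by rewrite eval_comorphism.
rewrite -[eval_at _ h']eval_comorphism h'E rmorphM /= -gE // mulrA.
by rewrite eval_comorphism -exprS [_ * f x]mulrC mulfK // expf_neq0.
Qed.

Lemma quotient_pullback (V : set Y) : open V -> pullback_iso a p V.
Proof.
move=> oV; have [cp pm] := quotient_morphism.
have oU : open (p @^-1` V) by move/continuousP : cp; exact.
have /choice[sec secK] : forall y, exists x, p x = y.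
  move=> y; have : [set: Y] y by [].
  by rewrite -quotient_surjective => -[x _]; exists x.
split.
- by move=> s Vs; split=> [|x g _]; [exact: pm|rewrite /= quotient_orbits].
- by move=> s t _ _ st y Vy; rewrite -(secK y); apply: st; rewrite /= secK.
move=> f invf.
(* Near each point of [V], [f] is a fraction of functions pulled back from [Y]; it is thus constant
   on fibres, so [f \o sec] is regular and pulls back to [f] whatever section was chosen. *)
have frac y : V y -> exists h n h', [/\ eval_at y h != 0,
    forall z, eval_at z h != 0 -> V z &
    forall x, eval_at (p x) h != 0 ->
      f x = eval_at (p x) h' / eval_at (p x) h ^+ n].
  move=> Vy; have [|//|h hy hV] := @affine_separate _ _ affY (~` V) y.
    exact: open_closedC.
  have {}hV z : eval_at z h != 0 -> V z.
    by move=> hz; apply: contrapT => /hV /eqP; exact/negP.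
  have [|n [h' E]] := @invariant_fraction _ f h oU invf.
    by move=> x; exact: hV.
  by exists h, n, h'.
exists (f \o sec).
  apply/(affine_regular affY _ oV) => y /frac[h [n [h' [hy hV E]]]].
  exists [set z | eval_at z h != 0], (eval_at^~ h'), (eval_at^~ (h ^+ n)).
  split=> //.
  - exact/global_nonzero_open/eval_at_global.
  - by split; exact: eval_at_global.
  - move=> z hz; rewrite rmorphXn expf_neq0 //; split=> //.
    by rewrite /= E secK.
move=> x /frac[h [n [h' [hy _ E]]]].
by rewrite /= !E ?secK.
Qed.

End AffineQuotient.

Theorem theorem6p3 (k : closedFieldType) (G : affineAlgebraicGroup k)
    (X : spaceWithFunctions k) (affX : is_affine X) (a : regular_action G X)
    (lrX : linearly_reductive_action a)
    (Y : spaceWithFunctions k) (affY : is_affine Y)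
    (phi : {rmorphism coord_algebra Y -> coord_algebra X})
    (invY : is_iso_onto_invariants a phi)
    (p : X -> Y) (p_phi : has_comorphism phi p) :
  is_semi_geometric_quotient a p.
Proof.
split.
- exact: affine_variety.
- exact: quotient_morphism p_phi.
- exact: (quotient_surjective affX affY invY p_phi lrX).
- exact: (quotient_orbits affY invY p_phi).
- exact: (quotient_pullback affX affY invY p_phi lrX).
- exact: (quotient_closed affX affY invY p_phi lrX).
- exact: (quotient_disjoint affX invY p_phi lrX).
Qed.
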